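(* Let $d\ge 1$, let $k\ge 1$ and $R>0$, and let $C\subset\mathbb{R}^d$ be a $k$-well-rounded cell of radius $R$. Let $c = 4k^2$. Then for every point $q\in\mathbb{R}^d$ and every radius $r>0$, either $cr \geq R$, or $$\frac{\mathrm{Vol}(B(q,r) \cap C)}{\mathrm{Vol}(B(q,cr) \cap C)} < 2^{-\left(\frac{d}{2}-1\right)}\, d ,$$ where the ratio is read as $0$ if its denominator (and hence its numerator) is $0$.
   Context: $\|\cdot\|$ is the Euclidean norm on $\mathbb{R}^d$, $B(x,r)$ is the $d$-dimensional ball of radius $r$ centered at $x$, and $\mathrm{Vol}$ is $d$-dimensional Lebesgue measure. A set (cell) $C\subset\mathbb{R}^d$ is called $k$-well-rounded of radius $R$ if $C$ is convex and there exists a point $p$ such that $B(p, \frac{R}{k}) \subseteq C \subseteq B(p, R)$. *)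

(* Defs.v *)
From HB Require Import structures.
From mathcomp Require Import all_boot all_order all_algebra.
From mathcomp Require Import all_classical all_reals all_analysis.

Set Implicit Arguments.
Unset Strict Implicit.
Unset Printing Implicit Defensive.

Import Order.TTheory GRing.Theory Num.Theory.

Local Open Scope classical_set_scope.
Local Open Scope ring_scope.

(* R^d is 'rV[R]_d; the library's norm `|x| on row vectors is the sup norm, so
   the Euclidean one is defined here. *)
Definition enorm (R : realType) (d : nat) (x : 'rV[R]_d) : R :=
  Num.sqrt (\sum_(i < d) x ord0 i ^+ 2).

Definition eball (R : realType) (d : nat) (x : 'rV[R]_d) (r : R) :
    set 'rV[R]_d :=
  [set y | enorm (y - x) <= r].

Definition well_rounded (R : realType) (d : nat) (k rad : R)
    (C : set 'rV[R]_d) : Prop :=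
  @convex_set R 'rV[R]_d C /\
  exists p : 'rV[R]_d, eball p (rad / k) `<=` C /\ C `<=` eball p rad.

Definition box (R : realType) (d : nat) (a b : 'rV[R]_d) : set 'rV[R]_d :=
  [set x | forall i, a ord0 i <= x ord0 i <= b ord0 i].

Definition box_cover (R : realType) (d : nat) (A : set 'rV[R]_d)
    (a b : nat -> 'rV[R]_d) : Prop :=
  (forall n i, a n ord0 i <= b n ord0 i) /\
  A `<=` \bigcup_n box (a n) (b n).

(* Lebesgue measure on R^d for d >= 1: the infimum of the total volume of
   countable covers by boxes.  Like the library's one-dimensional
   lebesgue_measure it is a total function on sets (the outer measure), and is
   the Lebesgue measure on Lebesgue measurable sets; these include all convex
   sets, which need not be Borel. *)
Definition Vol (R : realType) (d : nat) (A : set 'rV[R]_d) : \bar R :=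
  ereal_inf
    [set (\sum_(0 <= n <oo) (\prod_(i < d) (ab.2 n ord0 i - ab.1 n ord0 i))%:E)%E
     | ab in [set ab : (nat -> 'rV[R]_d) * (nat -> 'rV[R]_d) |
                box_cover A ab.1 ab.2]].

(* Main.v *)
Require Import Defs.
From mathcomp Require Import all_boot all_order all_algebra.
From mathcomp Require Import all_classical all_reals all_analysis.
From mathcomp Require Import ring lra.

Import Order.TTheory GRing.Theory Num.Theory.

Local Open Scope classical_set_scope.
Local Open Scope ring_scope.

(** Idea: pick a point [a] in both [C] and [B(q,r)].  By convexity, [C] contains
   the convex hull of [a] and the ball [B(p, R/k)], hence the image of that ball
   under any contraction towards [a].  The contraction with ratio
   [s = 3kr/(2R) <= 1] gives a ball of radius [3r/2] that is inside
   [C] and still inside [B(q, 4k^2 r)].  So a homothety of ratio [3/2] sends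
   [B(q,r)] into the denominator, the quotient is at most [(2/3)^d], and
   [2/3 < 2^(-1/2)]. *)

Section EuclideanNorm.
Context {R : realType} {d : nat}.
Implicit Types x y : 'rV[R]_d.

Lemma enorm_leE x (u : R) : 0 <= u ->
  (enorm x <= u) = (\sum_(i < d) x ord0 i ^+ 2 <= u ^+ 2).
Proof.
move=> u0; rewrite -[in LHS](ger0_norm u0) -sqrtr_sqr.
by rewrite ler_sqrt// sqr_ge0.
Qed.

(* By convexity of the square,
   [(x + y)^2 <= (u + v) (x^2 / u + y^2 / v)] in every coordinate. *)
Lemma enormD_le x y (u v : R) : 0 < u -> 0 < v ->
  enorm x <= u -> enorm y <= v -> enorm (x + y) <= u + v.
Proof.
move=> u0 v0; have [u_ge0 v_ge0] := (ltW u0, ltW v0).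
rewrite !enorm_leE ?addr_ge0// => xu yv.
apply: (@le_trans _ _ (\sum_(i < d) ((u + v) / u * x ord0 i ^+ 2 +
                                     (u + v) / v * y ord0 i ^+ 2))).
  apply: ler_sum => i _; rewrite mxE -subr_ge0.
  rewrite (_ : _ - _ = (v * x ord0 i - u * y ord0 i) ^+ 2 / (u * v)); last first.
    by field; rewrite !gt_eqF.
  by rewrite divr_ge0 ?sqr_ge0 ?mulr_ge0.
rewrite big_split/= -!mulr_sumr.
have -> : (u + v) ^+ 2 = (u + v) / u * u ^+ 2 + (u + v) / v * v ^+ 2.
  by field; rewrite !gt_eqF.
by apply: lerD; apply: ler_wpM2l => //; rewrite divr_ge0 ?addr_ge0.
Qed.

Lemma enormZ_le (t : R) x (u : R) : 0 <= u ->
  enorm x <= u -> enorm (t *: x) <= `|t| * u.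
Proof.
move=> u0; rewrite !enorm_leE ?mulr_ge0// => xu.
under eq_bigr do rewrite mxE exprMn.
by rewrite -mulr_sumr exprMn real_normK ?num_real// ler_wpM2l ?sqr_ge0.
Qed.

End EuclideanNorm.

Section Volume.
Context {R : realType} {d : nat}.
Implicit Types (A B : set 'rV[R]_d) (v : 'rV[R]_d) (t : R).

Lemma Vol_ge0 A : (0 <= Vol A)%E.
Proof.
apply: le_ereal_inf_tmp => _ [[a b] [ab _] <-]; apply: nneseries_ge0 => n _ _.
by rewrite lee_fin prodr_ge0// => i _; rewrite subr_ge0 ab.
Qed.

(** Pulling a box cover of [B] back along [x |-> t x + v] gives a box cover of [A] with every volume
    divided by [t ^ d]. This works directly on the infimum over covers. *)
Lemma Vol_homothety_le A B t v : 0 < t ->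
  (forall x, A x -> B (t *: x + v)) -> ((t ^+ d)%:E * Vol A <= Vol B)%E.
Proof.
move=> t0 AB; have td0 : 0 < t ^+ d by rewrite exprn_gt0.
apply: le_ereal_inf_tmp => _ [[a b] [/= ab Bab] <-].
set s := (X in (_ <= X)%E).
(* The factor [t ^- d * s] is the total volume of the pulled-back cover. *)
have -> : s = ((t ^+ d)%:E * ((t ^- d)%:E * s))%E.
  by rewrite muleA -EFinM divff ?gt_eqF// mul1e.
rewrite lee_pmul2l//; apply: ereal_inf_lbound.
exists (fun n => t^-1 *: (a n - v), fun n => t^-1 *: (b n - v)).
  split=> [n i|x /AB /Bab [n _ abx]]/=.
    by rewrite !mxE ler_pM2l ?invr_gt0// lerD2r.
  exists n => // i; have := abx i.
  by rewrite !mxE -!lerBlDr ler_pdivrMl// ler_pdivlMl// lerBlDr lerBrDr.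
rewrite -nneseriesZl; last first.
  by move=> n _; rewrite lee_fin prodr_ge0// => i _; rewrite subr_ge0 ab.
apply: eq_eseriesr => n _; rewrite -EFinM; congr EFin.
rewrite -exprVn -[in t^-1 ^+ d](card_ord d) -prodr_const -big_split/=.
by apply: eq_bigr => i _; rewrite !mxE -mulrBr; congr (_ * _); ring.
Qed.

End Volume.

Lemma lee_div_of_pmul {R : realType} (N D : \bar R) (t : R) : 0 < t ->
  (0 <= N)%E -> (0 <= D)%E -> (t%:E * N <= D)%E -> (N / D <= (t^-1)%:E)%E.
Proof.
move=> t0; have ti0 : 0 <= t^-1 by rewrite ltW ?invr_gt0.
case: D => [D| |]// N0 D0; last by rewrite invey mule0 lee_fin.
case: N N0 => [N| |]//; last by rewrite gt0_muley ?lte_fin.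
rewrite -EFinM !lee_fin => N0 ND.
(* A zero denominator forces [N = 0], so the quotient is [0 * +oo = 0]. *)
have [D00|D00] := eqVneq D 0.
  have -> : N = 0.
    by apply/eqP; rewrite eq_le N0 andbT -(pmulr_rle0 _ t0) -D00.
  by rewrite mul0e lee_fin.
have Dp : 0 < D by rewrite lt_neqAle eq_sym D00.
by rewrite inver (negbTE D00) -EFinM lee_fin ler_pdivrMr// ler_pdivlMl.
Qed.

(** With [w = 2^(-1/2)] the right side is [2 d w^d]. Since [(2/3)^2 = 4/9 <= 1/2 = w^2], the left
    side is at most [w^d], and [2 d > 1] makes the inequality strict. *)
Lemma powR_bound {R : realType} (d : nat) : (1 <= d)%N ->
  ((3 / 2) ^+ d)^-1 < 2 `^ (- (d%:R / 2 - 1)) * d%:R :> R.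
Proof.
move=> d1; set w : R := 2 `^ (- 2^-1).
have w0 : 0 < w by rewrite powR_gt0.
have w2 : w ^+ 2 = 2^-1.
  rewrite -powR_mulrn ?(ltW w0)// -powRrM mulNr mulVf ?pnatr_eq0//.
  by rewrite powR_inv1.
have -> : 2 `^ (- (d%:R / 2 - 1)) = 2 * w ^+ d :> R.
  rewrite -powR_mulrn ?(ltW w0)// -powRrM.
  rewrite (_ : - (d%:R / 2 - 1) = 1 + - 2^-1 * d%:R); last by ring.
  by rewrite powRD ?pnatr_eq0 ?implybT// powRr1.
have wd0 : 0 < w ^+ d by rewrite exprn_gt0.
have w23 : (3 / 2)^-1 <= w.
  by rewrite -(@ler_pXn2r _ 2) ?nnegrE ?invr_ge0 ?(ltW w0)// w2; lra.
apply: (@le_lt_trans _ _ (w ^+ d)).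
  by rewrite -exprVn lerXn2r ?nnegrE ?invr_ge0 ?(ltW w0).
have : 1 <= d%:R :> R by rewrite ler1n.
by nra.
Qed.

(* The image of [x] is the convex combination
   [(1 - s) a + s (p + (3 / (2 s)) (x - q))] with [s = 3 k r / (2 rad)]. *)
Lemma well_rounded_homothety {R : realType} {d : nat} (k rad r : R)
    (C : set 'rV[R]_d) (q a : 'rV[R]_d) :
  1 <= k -> 0 < rad -> 0 < r -> 4 * k ^+ 2 * r < rad ->
  well_rounded k rad C -> (eball q r `&` C) a ->
  exists v, forall x, (eball q r `&` C) x ->
    (eball q (4 * k ^+ 2 * r) `&` C) ((3 / 2) *: x + v).
Proof.
move=> k1 rad0 r0 crad [convC [p [pC Cp]]] [qa Ca].
have k0 : 0 < k by lra.
have h32 : 0 < 3 / 2 :> R by lra.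
have ap : enorm (a - p) <= rad by apply: (Cp a Ca).
set s := 3 * k * r / (2 * rad).
have s0 : 0 < s by rewrite divr_gt0 ?mulr_gt0.
have srad : s * rad = 3 / 2 * k * r by rewrite /s; field; rewrite gt_eqF.
clearbody s; have srad0 : 0 < s * rad by exact: mulr_gt0.
have r32 : 0 < 3 / 2 * r by exact: mulr_gt0.
have kk : k * r <= k ^+ 2 * r by rewrite ler_pM2r// expr2 ler_peMr// ltW.
have rk : r <= k * r by rewrite ler_peMl// ltW.
(* Indeed [s * rad = (3/2) k r <= 4 k^2 r < rad]. *)
have s1 : s <= 1 by rewrite -(ler_pM2r rad0) mul1r srad; nra.
exists ((1 - s) *: a + s *: p - (3 / 2) *: q) => x [qx _]; split.
  rewrite /eball/= (_ : _ - q =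
    (a - q) + ((- s) *: (a - p) + (3 / 2) *: (x - q))); last first.
    by apply/matrixP => i j; rewrite !mxE; ring.
  (* The three terms are at most [r], [(3/2) k r] and [(3/2) r]. As [r <= k r <= k^2 r], they add up
     to at most [(1 + 3/2 + 3/2) k^2 r], whence the constant 4. *)
  apply: (@le_trans _ _ (r + (s * rad + 3 / 2 * r))); last by rewrite srad; nra.
  apply: enormD_le => //; first exact: addr_gt0.
  apply: enormD_le => //.
    by rewrite -[s in leRHS](gtr0_norm s0) -normrN enormZ_le ?(ltW rad0).
  by rewrite -[3 / 2 in leRHS](gtr0_norm h32) enormZ_le ?(ltW r0).
(* The value of [s] is chosen so that [(3 / (2 s)) r] is exactly [rad / k], the radius of the inner
   ball. *)
have py : C (p + (3 / 2 / s) *: (x - q)).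
  apply: pC; rewrite /eball/= addrC addKr.
  have -> : rad / k = `|3 / 2 / s| * r.
    rewrite gtr0_norm ?divr_gt0// (_ : rad = 3 / 2 * k * r / s).
      by field; rewrite !gt_eqF.
    by rewrite -srad mulrAC divff ?mul1r// gt_eqF.
  by rewrite enormZ_le ?(ltW r0).
have -> : (3 / 2) *: x + ((1 - s) *: a + s *: p - (3 / 2) *: q) =
    s *: (p + (3 / 2 / s) *: (x - q)) + (1 - s) *: a.
  by apply/matrixP => i j; rewrite !mxE; field; rewrite gt_eqF.
by have /(_ (Itv01 (ltW s0) s1)) := convC _ _ _ (mem_set py) (mem_set Ca); rewrite inE.
Qed.

(* The quotient is taken in \bar R, where 0 / 0 = 0 * +oo = 0. *)
Theorem corollary2p2 (R : realType) (d : nat) (k rad : R) (C : set 'rV[R]_d)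
  (hd : (1 <= d)%N) (hk : 1 <= k) (hrad : 0 < rad)
  (hC : well_rounded k rad C) :
  let c := 4 * k ^+ 2 in
  forall (q : 'rV[R]_d) (r : R), 0 < r ->
    rad <= c * r \/
    (Vol (eball q r `&` C) / Vol (eball q (c * r) `&` C)
       < (2 `^ (- (d%:R / 2 - 1)) * d%:R)%:E)%E.
Proof.
move=> c q r r0; have [|crad] := leP rad (c * r); [by left|right].
have [v hv] : exists v, forall x, (eball q r `&` C) x ->
    (eball q (c * r) `&` C) ((3 / 2) *: x + v).
  (* Without a point [a] to contract towards, the inclusion is vacuous and any [v] will do. *)
  have [A0|/set0P[a Aa]] := eqVneq (eball q r `&` C) set0.
    by exists 0 => x; rewrite A0.
  exact: (well_rounded_homothety _ _ _ _ _ _ hk hrad r0 crad hC Aa).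
have h32 : 0 < 3 / 2 :> R by lra.
apply: (@le_lt_trans _ _ (((3 / 2) ^+ d)^-1%:E)).
  apply: lee_div_of_pmul; rewrite ?Vol_ge0 ?exprn_gt0//.
  exact: Vol_homothety_le hv.
by rewrite lte_fin powR_bound.
Qed.
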